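(* For every fixed integer $k \ge 1$, there are only finitely many (up to isomorphism) $k$-vertex-critical $(P_5, \overline{K_3+2P_1})$-free graphs.
   Context: All graphs are finite, simple and undirected. $P_t$ denotes the path on $t$ vertices, $K_n$ the complete graph on $n$ vertices, $G+H$ the disjoint union of $G$ and $H$, $2P_1$ two isolated vertices, and $\overline{G}$ the complement of $G$; thus $\overline{K_3+2P_1}$ is the complement of the disjoint union of a triangle and two isolated vertices. A graph is $(H_1,H_2)$-free if it contains no induced subgraph isomorphic to $H_1$ or to $H_2$. A graph $G$ is $k$-vertex-critical if $\chi(G)=k$ and $\chi(G-v)<k$ for every vertex $v\in V(G)$, where $\chi$ is the chromatic number. *)

(* Defs.v *)
From HB Require Import structures.
From mathcomp Require Import all_boot.

Set Implicit Arguments.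
Unset Strict Implicit.
Unset Printing Implicit Defensive.

Record sgraph := SGraph {
  vertex :> finType;
  edge : rel vertex;
  edge_sym : symmetric edge;
  edge_irr : irreflexive edge }.

Arguments edge {s} : rename.

Definition isomorphic (G H : sgraph) : Prop :=
  exists2 f : G -> H, bijective f & forall x y, edge (f x) (f y) = edge x y.

Section Induced.
Variables (G : sgraph) (S : {set G}).

Definition induced_edge : rel {x : G | x \in S} :=
  fun x y => edge (val x) (val y).

Fact induced_edge_sym : symmetric induced_edge.
Proof. by move=> x y; apply: edge_sym. Qed.

Fact induced_edge_irr : irreflexive induced_edge.
Proof. by move=> x; apply: edge_irr. Qed.

Definition induced : sgraph := SGraph induced_edge_sym induced_edge_irr.
End Induced.

Definition delete_vertex (G : sgraph) (v : G) : sgraph := induced [set~ v].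

Section Complement.
Variable G : sgraph.

Definition compl_edge : rel G := fun x y => (x != y) && ~~ edge x y.

Fact compl_edge_sym : symmetric compl_edge.
Proof. by move=> x y; rewrite /compl_edge eq_sym edge_sym. Qed.

Fact compl_edge_irr : irreflexive compl_edge.
Proof. by move=> x; rewrite /compl_edge eqxx. Qed.

Definition compl : sgraph := SGraph compl_edge_sym compl_edge_irr.
End Complement.

Section DisjointUnion.
Variables G H : sgraph.

Definition union_edge : rel (G + H)%type := fun x y =>
  match x, y with
  | inl a, inl b => edge a b
  | inr a, inr b => edge a b
  | _, _ => false
  end.

Fact union_edge_sym : symmetric union_edge.
Proof. by move=> [x|x] [y|y] //=; apply: edge_sym. Qed.

Fact union_edge_irr : irreflexive union_edge.
Proof. by move=> [x|x] /=; apply: edge_irr. Qed.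

Definition disjoint_union : sgraph := SGraph union_edge_sym union_edge_irr.
End DisjointUnion.

Section PathComplete.
Variable n : nat.

Definition path_edge : rel 'I_n :=
  fun i j => (i.+1 == j :> nat) || (j.+1 == i :> nat).

Fact path_edge_sym : symmetric path_edge.
Proof. by move=> i j; rewrite /path_edge orbC. Qed.

Fact path_edge_irr : irreflexive path_edge.
Proof. by move=> i; rewrite /path_edge orbb gtn_eqF. Qed.

Definition path_graph : sgraph := SGraph path_edge_sym path_edge_irr.

Definition complete_edge : rel 'I_n := fun i j => i != j.

Fact complete_edge_sym : symmetric complete_edge.
Proof. by move=> i j; rewrite /complete_edge eq_sym. Qed.

Fact complete_edge_irr : irreflexive complete_edge.
Proof. by move=> i; rewrite /complete_edge eqxx. Qed.

Definition complete_graph : sgraph :=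
  SGraph complete_edge_sym complete_edge_irr.
End PathComplete.

Definition P5 : sgraph := path_graph 5.

Definition twoP1 : sgraph := disjoint_union (path_graph 1) (path_graph 1).

Definition co_K3_2P1 : sgraph :=
  compl (disjoint_union (complete_graph 3) twoP1).

Definition is_free (H G : sgraph) : Prop :=
  forall S : {set G}, ~ isomorphic (induced S) H.

Definition colorable (G : sgraph) (n : nat) : bool :=
  [exists c : {ffun G -> 'I_n}, forall x, forall y, edge x y ==> (c x != c y)].

Fact colorable_exists (G : sgraph) : exists n, colorable G n.
Proof.
exists #|G|; apply/existsP; exists [ffun x => enum_rank x].
apply/forallP=> x; apply/forallP=> y; apply/implyP=> exy.
rewrite !ffunE (inj_eq enum_rank_inj); apply/eqP=> eq_xy.
by rewrite eq_xy edge_irr in exy.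
Qed.

Definition chromatic_number (G : sgraph) : nat := ex_minn (colorable_exists G).

Definition vertex_critical (k : nat) (G : sgraph) : Prop :=
  chromatic_number G = k /\
  forall v : G, chromatic_number (delete_vertex v) < k.

Definition finitely_many_up_to_iso (P : sgraph -> Prop) : Prop :=
  exists (n : nat) (L : 'I_n -> sgraph),
    forall G : sgraph, P G -> exists i : 'I_n, isomorphic G (L i).

(* Main.v *)
Require Import Defs.
From mathcomp Require Import all_boot.
From mathcomp Require Import zify.

Set Implicit Arguments.
Unset Strict Implicit.
Unset Printing Implicit Defensive.

(** The complement of K3 + 2P1 is K_{1,1,3}, so a k-colouring shows that any
    two adjacent vertices have at most 2k common neighbours. A critical graph
    is connected and a connected P5-free graph has diameter at most 3, so it
    suffices to bound the degree of every vertex v. The neighbourhood of v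
    induces a P5-free graph of degree at most 2k, whose components are
    therefore of bounded size. If there were many components, many of them
    would be isomorphic; by criticality, for any two such components K_i and
    K_j some vertex u not adjacent to v meets K_i and is not complete to K_j.
    P5-freeness shows that u is mixed on at most one component, and that two
    such vertices whose neighbourhoods differ in both directions on distinct
    components are adjacent; then they share at most two components to which
    both are complete. Ramsey's theorem for triples makes the traces of the
    separating vertices on the components homogeneous, and each of the
    resulting patterns yields a K_{1,1,3} or a clique of size k + 1. *)

(** * Ramsey's theorem for colourings of subsequences *)

Definition homogeneous (I : eqType) (C : Type) (r : nat) (f : seq I -> C)
    (t : seq I) (c : C) :=
  forall u, subseq u t -> size u = r -> f u = c.

(** Allowing a separate target length for each colour is what drives the inner induction: it runs on
    the sum of the targets, and each round lowers the target of one colour. *)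
Lemma ramsey_weighted (r : nat) (C : finType) (m : C -> nat) :
  exists N, forall (I : eqType) (f : seq I -> C) (s : seq I), N <= size s ->
    exists c t, [/\ subseq t s, size t = m c & homogeneous r f t c].
Proof.
elim: r m => [|r IHr] m.
  exists (\max_c m c) => I f s les; exists (f [::]), (take (m (f [::])) s).
  split; first exact: take_subseq.
    by rewrite size_takel // (leq_trans _ les) // (leq_bigmax (f [::])).
  by move=> u _ /size0nil->.
have [n] := ubnP (\sum_c m c); elim: n m => // n IHn m le_m.
have [/existsP[c /eqP mc0] | /existsPn m_gt0] := boolP [exists c, m c == 0].
  exists 0 => I f s _; exists c, [::]; split=> //; first exact: sub0seq.
  by move=> u /eqP->.
pose m' c d := if d == c then (m d).-1 else m d.
have /fin_all_exists[N NP] c : exists N, forall (I : eqType)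
    (f : seq I -> C) (s : seq I), N <= size s ->
    exists d t, [/\ subseq t s, size t = m' c d & homogeneous r.+1 f t d].
  apply: IHn; rewrite (bigD1 c) //= in le_m; rewrite (bigD1 c) //= /m' eqxx.
  rewrite (eq_bigr m) => [|d /negPf-> //].
  by have := m_gt0 c; lia.
(* If the subsequences starting with the head [x] have colour c on a tail [t], then [t] must have
   length [N c]; so the bounds [N] themselves serve as targets for length r. *)
have [N' N'P] := IHr N.
exists N'.+1 => I f [//|x s] /= les.
have [c [t [sts szt homt]]] := N'P I (fun u => f (x :: u)) s les.
have [d [t' [stt' szt' homt']]] := NP c I f t (eq_leq (esym szt)).
have st's := subseq_trans stt' sts.
(* Only when the colour found inside [t] agrees with that of the link of [x] can [x] be prepended,
   which restores the target lowered in [m']. *)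
have [eq_dc | neq_dc] := eqVneq d c; last first.
  exists d, t'; split=> //; last by rewrite szt' /m' (negPf neq_dc).
  exact: (subseq_trans st's (subseq_cons s x)).
exists c, (x :: t'); split; first by rewrite /= eqxx.
  by rewrite /= szt' eq_dc /m' eqxx prednK // lt0n m_gt0.
move=> [|y u] //= + [szu]; case: eqP => [-> sut|_ sut].
  exact/homt/szu/(subseq_trans sut stt').
by rewrite -eq_dc; apply: homt'; rewrite //= szu.
Qed.

Lemma ramsey (r : nat) (C : finType) (m : nat) :
  exists N, forall (I : eqType) (f : seq I -> C) (s : seq I), N <= size s ->
    exists c t, [/\ subseq t s, size t = m & homogeneous r f t c].
Proof. exact: (ramsey_weighted r (fun=> m)). Qed.

(** * Components of P5-free graphs of bounded degree *)

Lemma card_bigcup_le (I T : finType) (A : {set I}) (F : I -> {set T}) n :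
  (forall i, i \in A -> #|F i| <= n) -> #|\bigcup_(i in A) F i| <= #|A| * n.
Proof.
move=> leF; rewrite -sum_nat_const.
elim/big_rec2: _ => [|i m X iA IH]; first by rewrite cards0.
by rewrite (leq_trans (leq_card_setU _ _)) // leq_add ?leF.
Qed.

Section BoundedComponents.
Variables (T : finType) (e : rel T) (D : nat).
Hypothesis e_sym : symmetric e.
Hypothesis e_P5 : forall a b c d x, e a b -> e b c -> e c d -> e d x ->
  ~~ e a c -> ~~ e a d -> ~~ e a x -> ~~ e b d -> ~~ e b x -> ~~ e c x -> False.
Hypothesis e_deg : forall x, #|e x| <= D.

(** The ball of radius 3 around x is the whole component, since a vertex at distance 4 would end an
    induced P5 starting at x. *)
Lemma component_card x : #|connect e x| <= 1 + D + D ^ 2 + D ^ 3.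
Proof.
pose N (A : {set T}) := \bigcup_(a in A) [set y | e a y].
have NP (A : {set T}) y : reflect (exists2 a, a \in A & e a y) (y \in N A).
  by apply: (iffP bigcupP) => -[a aA]; rewrite ?inE => eay;
    exists a; rewrite ?inE.
have leN (A : {set T}) : #|N A| <= #|A| * D.
  by apply: card_bigcup_le => a _; rewrite cardsE.
pose S1 := N [set x]; pose S2 := N S1; pose S3 := N S2.
pose W := [set x] :|: S1 :|: S2 :|: S3.
have inW y : y \in W = [|| y == x, y \in S1, y \in S2 | y \in S3].
  by rewrite !inE -!orbA.
(* If z leaves the ball, y lies in none of the smaller balls, and the vertices z, y, c, b, x on a
   shortest way back form an induced P5. *)
have clW y z : y \in W -> e y z -> z \in W.
  move=> yW eyz; apply: contraT; rewrite !inW !negb_or.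
  case/and4P=> zx zS1 zS2 zS3.
  have N1 u : e x u -> u \in S1 by move=> exu; apply/NP; exists x; rewrite ?inE.
  have N2 u w : u \in S1 -> e u w -> w \in S2 by move=> *; apply/NP; exists u.
  have N3 u w : u \in S2 -> e u w -> w \in S3 by move=> *; apply/NP; exists u.
  have yS2 : y \notin S2 by apply: contra zS3 => /N3; apply.
  have yS1 : y \notin S1 by apply: contra zS2 => /N2; apply.
  have yx : y != x by apply: contra zS1 => /eqP yx; apply: N1; rewrite -yx.
  move: yW; rewrite inW (negPf yx) (negPf yS1) (negPf yS2) /= => /NP[c cS2 ecy].
  have cS1 : c \notin S1 by apply: contra yS2 => /N2; apply.
  case/NP: (cS2) => b bS1 ebc; case/NP: (bS1) => x' /set1P-> exb.
  exfalso; apply: (@e_P5 z y c b x); rewrite 1?e_sym //.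
  - by apply: contra zS3; apply: N3.
  - by apply: contra zS2; apply: N2.
  - by apply: contra zS1; apply: N1.
  - by apply: contra yS2; apply: N2.
  - by apply: contra yS1; apply: N1.
  - by apply: contra cS1; apply: N1.
have: connect e x \subset W.
  have clP p u : path e u p -> u \in W -> last u p \in W.
    elim: p u => [|z p IH] u //= /andP[euz ep] uW.
    exact: IH ep (clW _ _ uW euz).
  by apply/subsetP=> y /connectP[p ep ->]; rewrite clP // inW eqxx.
move/subset_leq_card/leq_trans; apply.
have l1 : #|S1| <= D by have := leN [set x]; rewrite cards1 mul1n.
have l2 : #|S2| <= D ^ 2 by rewrite (leq_trans (leN _)) // expnS expn1 leq_mul.
have l3 : #|S3| <= D ^ 3 by rewrite (leq_trans (leN _)) // expnSr leq_mul.
rewrite (leq_trans (leq_card_setU _ _)) // leq_add //.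
rewrite (leq_trans (leq_card_setU _ _)) // leq_add //.
by rewrite (leq_trans (leq_card_setU _ _)) // leq_add // cards1.
Qed.
End BoundedComponents.

(** * Traces of separating vertices and the Ramsey argument *)

Lemma subseq_nth3 (I : eqType) (x0 : I) (t : seq I) a b c :
  a < b -> b < c -> c < size t ->
  subseq [:: nth x0 t a; nth x0 t b; nth x0 t c] t.
Proof.
move=> ab bc ct.
have drop_cons n : n < size t -> drop n t = nth x0 t n :: drop n.+1 t.
  exact: drop_nth.
have step n p u : n < p -> p < size t -> subseq u (drop p t) ->
    subseq (nth x0 t n :: u) (drop n t).
  move=> np pt up; rewrite drop_cons ?(ltn_trans np) //= eqxx.
  by rewrite (subseq_trans up) // -(subnK np) -drop_drop drop_subseq.
rewrite -[X in subseq _ X](cat_take_drop a) -[X in subseq X _]cat0s.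
apply: cat_subseq; first exact: sub0seq.
apply: (step _ b) => //; first exact: ltn_trans ct.
apply: (step _ c) => //.
by rewrite drop_cons //= eqxx sub0seq.
Qed.


(* In the two lemmas below, indices stand for the components of the           *)
(* neighbourhood of a vertex and elements of U for vertices: T u i means that *)
(* u has a neighbour in component i, F u i that u is complete to it.          *)
Definition trace_diff (I U : Type) (T F : U -> I -> bool) y z p :=
  T y p && ~~ T z p || F y p && ~~ F z p.

(** By [mixed1] each of the four repeated traces is all or nothing. If [g i j], or [g j i], misses
    everything on both sides of the pair, disjoint pairs give a clique; otherwise two adjacent
    vertices are complete to three common components. The clique uses indices up to 2k + 1 and the
    other configurations use indices up to 8; both stay below [m]. *)
Lemma homogeneous_traces_absurd (k : nat) (U : Type) (P : pred U) (adj : rel U)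
    (T F : U -> nat -> bool) (g : nat -> nat -> U) (m := k.*2 + 9)
    (c1 c2 c3 c4 : bool * bool) :
  (forall u i, F u i -> T u i) ->
  (forall u p q, P u -> p < m -> q < m ->
     T u p -> ~~ F u p -> T u q -> ~~ F u q -> p = q) ->
  (forall y z p q, P y -> P z -> p < m -> q < m -> p != q ->
     trace_diff T F y z p -> trace_diff T F z y q -> adj y z) ->
  (forall y z p q r, adj y z -> p < q -> q < r -> r < m ->
     F y p -> F y q -> F y r -> F z p -> F z q -> F z r -> False) ->
  (forall u : nat -> U, (forall i j, i < j -> j <= k -> adj (u i) (u j)) ->
     False) ->
  (forall i j, i < m -> j < m -> i != j ->
     [/\ P (g i j), T (g i j) i & ~~ F (g i j) j]) ->
  (forall i j p, i < j -> j < p -> p < m ->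
     [/\ (T (g i j) p, F (g i j) p) = c1, (T (g j i) p, F (g j i) p) = c2,
         (T (g j p) i, F (g j p) i) = c3 & (T (g p j) i, F (g p j) i) = c4]) ->
  False.
Proof.
move=> FT mixed1 D_adj common2 clique_le g_sep hom.
have m9 : 9 <= m by rewrite leq_addl.
have gP i j : i < m -> j < m -> i != j -> P (g i j).
  by move=> im jm ij; case: (g_sep i j).
have gT i j : i < m -> j < m -> i != j -> T (g i j) i.
  by move=> im jm ij; case: (g_sep i j).
have gF i j : i < m -> j < m -> i != j -> F (g i j) j = false.
  by move=> im jm ij; case: (g_sep i j) => // _ _ /negPf.
(* The value (true, false) would make u mixed on both p and q, and (false, true) contradicts
   [FT]. *)
have unmixed u p q c : P u -> p < q -> q < m -> (T u p, F u p) = c ->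
    (T u q, F u q) = c -> c = (c.1, c.1).
  case: c => [[] []] // Pu pq qm [Tp Fp] [Tq Fq]; last first.
    by have := FT u p Fp; rewrite Tp.
  have := mixed1 u p q Pu (ltn_trans pq qm) qm; rewrite Tp Fp Tq Fq.
  by move=> /(_ isT isT isT isT) epq; rewrite epq ltnn in pq.
have [a Ea] : exists a, c3 = (a, a).
  exists c3.1; apply: (@unmixed (g 2 3) 0 1); rewrite ?gP //; try lia.
    by case: (hom 0 2 3) => //; lia.
  by case: (hom 1 2 3) => //; lia.
have [a' Ea'] : exists a, c4 = (a, a).
  exists c4.1; apply: (@unmixed (g 3 2) 0 1); rewrite ?gP //; try lia.
    by case: (hom 0 2 3) => //; lia.
  by case: (hom 1 2 3) => //; lia.
have [b Eb] : exists b, c1 = (b, b).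
  exists c1.1; apply: (@unmixed (g 0 1) 2 3); rewrite ?gP //; try lia.
    by case: (hom 0 1 2) => //; lia.
  by case: (hom 0 1 3) => //; lia.
have [b' Eb'] : exists b, c2 = (b, b).
  exists c2.1; apply: (@unmixed (g 1 0) 2 3); rewrite ?gP //; try lia.
    by case: (hom 0 1 2) => //; lia.
  by case: (hom 0 1 3) => //; lia.
(* For i < j, the booleans a and b tell whether g i j meets the components    *)
(* below i, respectively above j; a' and b' do the same for g j i.            *)
have low i j p : p < i -> i < j -> j < m ->
    (T (g i j) p = a) * (F (g i j) p = a).
  by move=> pi ij jm; case: (hom p i j) => // _ _; rewrite Ea => -[-> ->].
have low' i j p : p < i -> i < j -> j < m ->
    (T (g j i) p = a') * (F (g j i) p = a').
  by move=> pi ij jm; case: (hom p i j) => // _ _ _; rewrite Ea' => -[-> ->].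
have high i j p : i < j -> j < p -> p < m ->
    (T (g i j) p = b) * (F (g i j) p = b).
  by move=> pi ij jm; case: (hom i j p) => //; rewrite Eb => -[-> ->].
have high' i j p : i < j -> j < p -> p < m ->
    (T (g j i) p = b') * (F (g j i) p = b').
  by move=> pi ij jm; case: (hom i j p) => // _; rewrite Eb' => -[-> ->].
have diffT y z p : T y p -> T z p = false -> trace_diff T F y z p.
  by rewrite /trace_diff => -> ->.
have diffF y z p : F y p -> F z p = false -> trace_diff T F y z p.
  by rewrite /trace_diff => -> ->; rewrite orbT.
have absurd i j i' j' p q r d d' : i < m -> j < m -> i' < m -> j' < m ->
    i != j -> i' != j' -> d < m -> d' < m -> d != d' ->
    p < q -> q < r -> r < m ->
    F (g i j) p -> F (g i j) q -> F (g i j) r ->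
    F (g i' j') p -> F (g i' j') q -> F (g i' j') r ->
    trace_diff T F (g i j) (g i' j') d -> trace_diff T F (g i' j') (g i j) d' ->
    False.
  move=> im jm im' jm' ij ij' dm dm' dd' pq qr rm ? ? ? ? ? ? D1 D2.
  apply: (common2 (g i j) (g i' j') p q r) => //.
  by apply: D_adj dd' D1 D2; rewrite ?gP.
have clique (h : nat -> nat * nat) (d : nat -> nat) :
    (forall n, n <= k -> [/\ (h n).1 < m, (h n).2 < m, (h n).1 != (h n).2
       & d n < m]) ->
    (forall n n', n <= k -> n' <= k -> n != n' -> (d n != d n') &&
      trace_diff T F (g (h n).1 (h n).2) (g (h n').1 (h n').2) (d n)) -> False.
  move=> hm hD; apply: (clique_le (fun n => g (h n).1 (h n).2)) => n n' nn' n'k.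
  have nk : n <= k by lia.
  have [h1 h2 h12 dm] := hm n nk; have [h1' h2' h12' dm'] := hm n' n'k.
  have /andP[dd' D1] : _ && _ := hD n n' nk n'k (ltac:(lia)).
  have /andP[_ D2] : _ && _ := hD n' n n'k nk (ltac:(lia)).
  by apply: D_adj dd' D1 D2; rewrite ?gP.
(* [g 3 4] and [g 5 6] are both complete to 0, 1, 2. The first is complete to 6 and the second is
   not; the reverse holds at 4. *)
have [ab|nab] := boolP (a && b).
  case/andP: ab => ha hb.
  apply: (absurd 3 4 5 6 0 1 2 6 4); try lia; try by rewrite low //; lia.
    by apply: diffF; [rewrite high //; lia | rewrite gF; lia].
  by apply: diffF; [rewrite low //; lia | rewrite gF; lia].
have [ab'|nab'] := boolP (a' && b').
  case/andP: ab' => ha hb.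
  apply: (absurd 4 3 6 5 0 1 2 5 3); try lia; try by rewrite low' //; lia.
    by apply: diffF; [rewrite high' //; lia | rewrite gF; lia].
  by apply: diffF; [rewrite low' //; lia | rewrite gF; lia].
(* Here [g (2n) (2n+1)] meets 2n and misses everything outside its own pair, so the vertices for n =
   0, ..., k are pairwise incomparable, hence pairwise adjacent. *)
have [oab|noab] := boolP (a || b); last first.
  case/norP: noab => /negPf ha /negPf hb.
  apply: (clique (fun n => (n.*2, n.*2.+1)) (fun n => n.*2)) => /= [n|n n'] nk.
    by split; lia.
  move=> nk' nn'; apply/andP; split; first lia.
  rewrite /trace_diff gT; try lia.
  have [lt|gt|] := ltngtP n n'; last lia; first by rewrite low ?ha //; lia.
  by rewrite high ?hb //; lia.
have [oab'|noab'] := boolP (a' || b'); last first.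
  case/norP: noab' => /negPf ha /negPf hb.
  apply: (clique (fun n => (n.*2.+1, n.*2)) (fun n => n.*2.+1))
    => /= [n|n n'] nk.
    by split; lia.
  move=> nk' nn'; apply/andP; split; first lia.
  rewrite /trace_diff gT; try lia.
  have [lt|gt|] := ltngtP n n'; last lia; first by rewrite low' ?ha //; lia.
  by rewrite high' ?hb //; lia.
(* Now both orders are complete on exactly one side and miss the other. The three common components
   lie on the complete sides; the two differences come from a missed side or from the defining
   property of [g]. *)
case: a low nab oab {Ea} => low; case: b high {Eb} => high // _ _;
  case: a' low' nab' oab' {Ea'} => low'; case: b' high' {Eb'} => high' // _ _.
- apply: (absurd 4 5 6 3 0 1 2 3 6); try lia;
    try (by rewrite low //; lia); try (by rewrite low' //; lia).
    by apply: diffF; [rewrite low //; lia | rewrite gF; lia].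
  by apply: diffT; [rewrite gT; lia | rewrite high; lia].
- apply: (absurd 6 7 2 1 3 4 5 0 8); try lia;
    try (by rewrite low //; lia); try (by rewrite high' //; lia).
    by apply: diffT; [rewrite low //; lia | rewrite low'; lia].
  by apply: diffT; [rewrite high' //; lia | rewrite high; lia].
- apply: (absurd 1 2 7 6 3 4 5 8 0); try lia;
    try (by rewrite high //; lia); try (by rewrite low' //; lia).
    by apply: diffT; [rewrite high //; lia | rewrite high'; lia].
  by apply: diffT; [rewrite low' //; lia | rewrite low; lia].
apply: (absurd 0 3 2 1 4 5 6 0 3); try lia;
  try (by rewrite high //; lia); try (by rewrite high' //; lia).
  by apply: diffT; [rewrite gT; lia | rewrite low'; lia].
by apply: diffF; [rewrite high' //; lia | rewrite gF; lia].
Qed.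

Lemma trace_system_bound (k : nat) : exists N,
  forall (I : eqType) (U : Type) (P : pred U) (adj : rel U)
    (T F : U -> I -> bool) (g : I -> I -> U) (s : seq I), uniq s ->
  (forall u i, F u i -> T u i) ->
  (forall u p q, P u -> p \in s -> q \in s ->
     T u p -> ~~ F u p -> T u q -> ~~ F u q -> p = q) ->
  (forall y z p q, P y -> P z -> p \in s -> q \in s -> p != q ->
     trace_diff T F y z p -> trace_diff T F z y q -> adj y z) ->
  (forall y z p q r, adj y z -> p \in s -> q \in s -> r \in s ->
     uniq [:: p; q; r] ->
     F y p -> F y q -> F y r -> F z p -> F z q -> F z r -> False) ->
  (forall u : nat -> U, (forall i j, i < j -> j <= k -> adj (u i) (u j)) ->
     False) ->
  (forall i j, i \in s -> j \in s -> i != j ->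
     [/\ P (g i j), T (g i j) i & ~~ F (g i j) j]) ->
  size s < N.
Proof.
pose B := (bool * bool)%type; pose m := k.*2 + 9.
have [N NP] := ramsey 3 (option (B * B * B * B)) m.
exists N => I U P adj T F g s s_uniq FT mixed1 D_adj common2 clique_le g_sep.
(* The colour of a triple records, for its first two and its last two members in both orders, the
   trace of the separating vertex on the remaining member. [None] is the default for other
   lengths. *)
rewrite ltnNge; apply/negP=> /(NP I (fun u => if u is [:: i; j; p] then
  Some ((T (g i j) p, F (g i j) p), (T (g j i) p, F (g j i) p),
         (T (g j p) i, F (g j p) i), (T (g p j) i, F (g p j) i)) else None)).
case=> c [t [sts szt hom]].
have [x0 _] : exists x0, x0 \in t.
  case: (t) szt => [|x0 t']; by [rewrite /m addnS
    | exists x0; rewrite mem_head].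
pose x := nth x0 t.
have t_uniq : uniq t := subseq_uniq sts s_uniq.
have xs i : i < m -> x i \in s.
  by move=> im; apply: (mem_subseq sts); rewrite mem_nth ?szt.
have xE i j : i < m -> j < m -> (x i == x j) = (i == j).
  by move=> im jm; rewrite nth_uniq ?szt.
have hom3 i j p : i < j -> j < p -> p < m -> Some
   ((T (g (x i) (x j)) (x p), F (g (x i) (x j)) (x p)),
    (T (g (x j) (x i)) (x p), F (g (x j) (x i)) (x p)),
    (T (g (x j) (x p)) (x i), F (g (x j) (x p)) (x i)),
    (T (g (x p) (x j)) (x i), F (g (x p) (x j)) (x i))) = c.
  move=> ij jp pm; rewrite -(hom [:: x i; x j; x p]) //.
  by apply: subseq_nth3; rewrite ?szt.
case: c {hom} hom3 => [[[[c1 c2] c3] c4]|] hom3; last first.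
  by have := hom3 0 1 2 isT isT; rewrite /m => /(_ (ltac:(lia))).
apply: (@homogeneous_traces_absurd k U P adj (fun u i => T u (x i))
  (fun u i => F u (x i)) (fun i j => g (x i) (x j)) c1 c2 c3 c4).
- by move=> u i; apply: FT.
- move=> u p q Pu pm qm Tp Fp Tq Fq; apply/eqP; rewrite -xE //; apply/eqP.
  by apply: (mixed1 u); rewrite ?xs.
- move=> y z p q Py Pz pm qm pq; apply: D_adj; rewrite ?xs ?xE //.
- move=> y z p q r ayz pq qr rm; apply: common2; rewrite ?xs //; try lia.
  by rewrite /= !inE !xE; lia.
- exact: clique_le.
- by move=> i j im jm ij; apply: g_sep; rewrite ?xs ?xE.
move=> i j p ij jp pm; by have [-> -> -> ->] := hom3 i j p ij jp pm.
Qed.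

(** * Critical graphs and the neighbourhood of a vertex *)

(** In [crit_P5] the given edges and non-edges already force the five vertices to be distinct. The
    last two fields use natural numbers as colours, so that a colouring of the graph without v may
    take any value at v. *)
Record critical_P5_K113_free (k : nat) (T : finType) (e : rel T) : Prop := {
  crit_sym : symmetric e;
  crit_P5 : forall a b c d x, e a b -> e b c -> e c d -> e d x ->
    ~~ e a c -> ~~ e a d -> ~~ e a x -> ~~ e b d -> ~~ e b x -> ~~ e c x ->
    False;
  crit_K113 : forall x y p q r, e x y -> uniq [:: p; q; r] ->
    ~~ e p q -> ~~ e p r -> ~~ e q r ->
    e x p -> e x q -> e x r -> e y p -> e y q -> e y r -> False;
  crit_colorable : exists c : T -> 'I_k, forall x y, e x y -> c x != c y;
  crit_not_colorable : forall c : T -> nat, (forall x, c x < k.-1) ->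
    ~ (forall x y, e x y -> c x != c y);
  crit_delete : forall v, exists2 c : T -> nat, forall x, x != v -> c x < k.-1 &
    forall x y, x != v -> y != v -> e x y -> c x != c y }.

Section Critical.
Variables (k : nat) (T : finType) (e : rel T).
Hypothesis crit : critical_P5_K113_free k e.
Let e_sym := crit_sym crit.

(** Extending f by the identity outside X gives an endomorphism of the graph that avoids x0;
    composed with a colouring of the graph minus x0 it would colour the whole graph with too few
    colours. *)
Lemma crit_no_retraction (X : {set T}) (x0 : T) (f : T -> T) : x0 \in X ->
  (forall x, x \in X -> f x \notin X) ->
  {in X &, forall x y, e x y -> e (f x) (f y)} ->
  (forall x y, x \in X -> y \notin X -> e x y -> e (f x) y) -> False.
Proof.
move=> x0X fX fhom fout; have [c c_lt cP] := crit_delete crit x0.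
pose h x := if x \in X then f x else x.
have h_neq x : h x != x0.
  by rewrite /h; case: ifPn => [/fX|] xX; apply: contraNneq xX => ->.
apply: (crit_not_colorable crit (c := c \o h)) => [x|x y exy] /=.
  exact: c_lt.
apply: cP => //; rewrite /h.
case: ifPn => xX; case: ifPn => yX //; [exact: fhom | exact: fout |].
by rewrite e_sym; apply: fout; rewrite // e_sym.
Qed.

(** Otherwise a colouring that omits y, used on the component of x, and one that omits x, used
    elsewhere, combine into a colouring of the whole graph. *)
Lemma crit_connected x y : connect e x y.
Proof.
apply: contraT => nxy.
have [cx cx_lt cxP] := crit_delete crit x.
have [cy cy_lt cyP] := crit_delete crit y.
have ny z : connect e x z -> z != y by apply: contraTneq => ->.
have nx z : ~~ connect e x z -> z != x.
  by apply: contraNneq => ->; apply: connect0.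
pose c z := if connect e x z then cy z else cx z.
exfalso; apply: (crit_not_colorable crit (c := c)) => [z|a b eab]; rewrite /c.
  by case: ifPn => [/ny/cy_lt|/nx/cx_lt].
have -> : connect e x b = connect e x a.
  apply/idP/idP => h; last exact: connect_trans h (connect1 eab).
  by apply: connect_trans h (connect1 _); rewrite e_sym.
have [xa | nxa] := ifPn.
  by apply: cyP => //; apply: ny => //; apply: connect_trans xa (connect1 eab).
apply: cxP => //; apply: nx => //; apply: contra nxa => xb.
by apply: connect_trans xb (connect1 _); rewrite e_sym.
Qed.

(** Three common neighbours in one colour class would be independent and form a K_{1,1,3} with x and
    y, so each class contributes at most two. *)
Lemma crit_codegree x y : e x y -> #|[set z | e x z && e y z]| <= k.*2.
Proof.
move=> exy; have [c cP] := crit_colorable crit; set A := [set z | _].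
have /subset_leq_card/leq_trans -> // :
    A \subset \bigcup_(i in [set: 'I_k]) [set z in A | c z == i].
  apply/subsetP=> z; rewrite inE => zA; apply/bigcupP; exists (c z).
    by rewrite inE.
  by rewrite !inE zA eqxx.
rewrite -muln2 -[X in _ <= X * 2]card_ord -cardsT; apply: card_bigcup_le => i _.
rewrite leqNgt; apply/card_gt2P => -[p [q [r [[]]]]].
rewrite !inE => /andP[/andP[xp yp] /eqP cp] /andP[/andP[xq yq] /eqP cq].
move=> /andP[/andP[xr yr] /eqP cr] [pq qr rp].
have nonadj a b : c a = i -> c b = i -> ~~ e a b.
  by move=> ca cb; apply/negP=> /cP; rewrite ca cb eqxx.
apply: (crit_K113 crit exy (p := p) (q := q) (r := r)); rewrite ?nonadj //.
by rewrite /= !inE negb_or pq qr eq_sym rp.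
Qed.

Lemma crit_clique (u : nat -> T) :
  (forall i j, i < j -> j <= k -> e (u i) (u j)) -> False.
Proof.
move=> uP; have [c cP] := crit_colorable crit.
suff /leq_card : injective (fun i : 'I_k.+1 => c (u i)).
  by rewrite !card_ord ltnn.
move=> i j /eqP; apply: contraTeq; rewrite -val_eqE neq_ltn.
case/orP=> ij; last rewrite eq_sym.
  by apply/cP/uP; rewrite // -ltnS ltn_ord.
by apply/cP/uP; rewrite // -ltnS ltn_ord.
Qed.

Section Neighborhood.
Variable v : T.

(** The graph induced on the neighbourhood of v, kept as a relation on all of [T]; vertices outside
    the neighbourhood become isolated. *)
Definition nbr_rel : rel T := fun x y => [&& e v x, e v y & e x y].
Local Notation K := (connect nbr_rel).
Definition meets u i := [exists a, K i a && e u a].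
Definition complete_to u i := [forall a, K i a ==> e u a].

Lemma nbr_rel_sym : symmetric nbr_rel.
Proof. by move=> x y; rewrite /nbr_rel [e x y]e_sym andbCA. Qed.

Lemma nbr_connect_sym : connect_sym nbr_rel.
Proof. exact: sym_connect_sym nbr_rel_sym. Qed.

Lemma nbr_component i a : e v i -> K i a -> e v a.
Proof.
move=> vi ia; have cl : closed nbr_rel (e v).
  by move=> x y /and3P[vx vy _]; rewrite !unfold_in vx vy.
by have := closed_connect cl ia; rewrite !unfold_in vi => <-.
Qed.

Lemma nbr_component_card i :
  #|K i| <= 1 + k.*2 + k.*2 ^ 2 + k.*2 ^ 3.
Proof.
apply: component_card => [|a b c d x|x]; first exact: nbr_rel_sym.
  rewrite /nbr_rel => /and3P[-> -> ab] /and3P[_ -> bc] /and3P[_ -> cd].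
  by move=> /and3P[_ -> dx] /=; apply: (crit_P5 crit).
have [vx | nvx] := boolP (e v x); last first.
  by rewrite eq_card0 // => y; rewrite unfold_in /nbr_rel (negPf nvx).
apply: leq_trans (crit_codegree vx); apply/subset_leq_card/subsetP=> y.
by rewrite unfold_in inE => /and3P[_ -> ->].
Qed.

Lemma nbr_nonadjacent p q a b : e v p -> e v q -> ~~ K p q ->
  K p a -> K q b -> ~~ e a b.
Proof.
move=> vp vq + pa qb; apply: contra => eab.
apply: (connect_trans pa); apply: (@connect_trans _ _ b).
  by apply: connect1; rewrite /nbr_rel eab (nbr_component vp pa)
    (nbr_component vq qb).
by rewrite nbr_connect_sym.
Qed.

(** Otherwise the neighbours of u in the component would be closed under [nbr_rel] and fill it. *)
Lemma mixed_edge u p : meets u p -> ~~ complete_to u p ->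
  exists a b, [/\ K p a, K p b, e a b, e u a & ~~ e u b].
Proof.
move=> /existsP[a0 /andP[pa0 ua0]] /forallPn[b0]; rewrite negb_imply.
case/andP=> pb0 nub0.
have [/existsP[a /existsP[b /and4P[pa ab ua nub]]] | noedge] :=
  boolP [exists a, exists b, [&& K p a, nbr_rel a b, e u a & ~~ e u b]].
  exists a, b; split=> //; first exact: connect_trans pa (connect1 ab).
  by case/and3P: ab.
have step a b : nbr_rel a b -> K p a && e u a -> K p b && e u b.
  move=> ab /andP[pa ua]; rewrite (connect_trans pa (connect1 ab)) /=.
  apply: contraNT noedge => nub.
  apply/existsP; exists a; apply/existsP; exists b.
  by rewrite pa ab ua.
have cl : closed nbr_rel [pred a | K p a && e u a].
  move=> a b ab; apply/idP/idP; first exact: step.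
  by apply: step; rewrite nbr_rel_sym.
have a0b0 : K a0 b0 by apply: connect_trans pb0; rewrite nbr_connect_sym.
by move: (closed_connect cl a0b0); rewrite !inE pa0 pb0 ua0 (negPf nub0).
Qed.

(** Edges a b and a' b' on which u is mixed, taken in different components, give the induced P5 b,
    a, u, a', b'. *)
Lemma mixed_component_unique u p q : e v p -> e v q ->
  meets u p -> ~~ complete_to u p -> meets u q -> ~~ complete_to u q -> K p q.
Proof.
move=> vp vq /mixed_edge/[apply]-[a [b [pa pb ab ua nub]]].
move=> /mixed_edge/[apply]-[a' [b' [qa' qb' ab' ua' nub']]].
apply: contraT => npq; have nadj := nbr_nonadjacent vp vq npq.
exfalso; apply: (crit_P5 crit (a := b) (b := a) (c := u) (d := a') (x := b'))
  => //; by [apply: nadj | rewrite e_sym].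
Qed.

Lemma trace_diff_vertex y z p : trace_diff meets complete_to y z p ->
  exists2 a, K p a & e y a && ~~ e z a.
Proof.
case/orP=> /andP[].
  move=> /existsP[a /andP[pa ya]] /existsPn/(_ a); rewrite pa /= => za.
  by exists a; rewrite ?ya.
move=> /forallP yp /forallPn[a]; rewrite negb_imply => /andP[pa za].
by exists a; rewrite ?za ?andbT //; apply: (implyP (yp a)).
Qed.

(** Private neighbours a of y and b of z in different components give the path y, a, v, b, z, which
    is induced unless y and z are adjacent. *)
Lemma trace_diff_adjacent y z p q : ~~ e v y -> ~~ e v z -> e v p -> e v q ->
  ~~ K p q -> trace_diff meets complete_to y z p ->
  trace_diff meets complete_to z y q -> e y z.
Proof.
move=> nvy nvz vp vq npq /trace_diff_vertex[a pa /andP[ya nza]].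
move=> /trace_diff_vertex[b qb /andP[zb nyb]]; apply: contraT => nyz.
have va := nbr_component vp pa; have vb := nbr_component vq qb.
exfalso; apply: (crit_P5 crit (a := y) (b := a) (c := v) (d := b) (x := z))
  => //.
- by rewrite e_sym.
- by rewrite e_sym.
- by rewrite e_sym.
- exact: nbr_nonadjacent pa qb.
- by rewrite e_sym.
Qed.

Let B := 1 + k.*2 + k.*2 ^ 2 + k.*2 ^ 3.
(** Surplus labels repeat [i], so components of different sizes share the label set ['I_B] and their
    types range over one finite set of matrices. *)
Definition label i (l : 'I_B) := nth i (enum (K i)) l.
Definition component_type i : {ffun 'I_B * 'I_B -> bool} :=
  [ffun p => e (label i p.1) (label i p.2)].

Lemma label_connect i l : K i (label i l).
Proof.
have [lt|ge] := ltnP l (size (enum (K i))); last first.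
  by rewrite /label nth_default.
by have := mem_nth i lt; rewrite mem_enum.
Qed.

Lemma label_onto i a : K i a -> exists l, label i l = a.
Proof.
move=> ia; have a_in : a \in enum (K i) by rewrite mem_enum.
have lt : index a (enum (K i)) < B.
  by apply: leq_trans (nbr_component_card i); rewrite cardE index_mem.
by exists (Ordinal lt); rewrite /label nth_index.
Qed.

(* Otherwise component i could be recoloured like its copy j. *)
Lemma separating_vertex i j : e v i -> e v j -> ~~ K i j ->
  component_type i = component_type j ->
  exists u, [&& ~~ e v u, meets u i & ~~ complete_to u j].
Proof.
move=> vi vj nij eq_type; apply/existsP; apply: contraT => /existsPn nosep.
(* Any label of x serves, since equal types carry edges over for every choice of labels. *)
pose f x := if [pick l | label i l == x] is Some l then label j l else x.
have fP x : K i x -> exists2 l, x = label i l & f x = label j l.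
  move=> ix; rewrite /f; case: pickP => [l /eqP<-|nol]; first by exists l.
  by have [l /eqP] := label_onto ix; rewrite nol.
exfalso; apply: (@crit_no_retraction [set x | K i x] i f) => [|x|x y|x y].
- by rewrite inE connect0.
- rewrite !inE => /fP[l _ ->]; apply: contra nij => /connect_trans; apply.
  by rewrite nbr_connect_sym label_connect.
- rewrite !inE => /fP[l -> ->] /fP[l' -> ->].
  by have /ffunP/(_ (l, l')) := eq_type; rewrite !ffunE /= => ->.
rewrite !inE => ix niy exy; have vx := nbr_component vi ix.
(* A neighbour y of the component lying outside it is either v or a non-neighbour of v. As it meets
   component i, the failure of separation makes it complete to component j, hence adjacent to the
   image of x. *)
have nvy : ~~ e v y.
  apply: contra niy => vy; apply: connect_trans ix (connect1 _).
  by rewrite /nbr_rel vx vy.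
have [l xl ->] := fP x ix; have := nosep y; rewrite nvy /=.
have -> /= : meets y i by apply/existsP; exists x; rewrite ix e_sym.
by rewrite negbK => /forallP/(_ (label j l)); rewrite label_connect e_sym.
Qed.
End Neighborhood.
End Critical.

(** * Bounds on degree and order *)

Lemma crit_degree_bound (k : nat) : exists D, forall (T : finType) (e : rel T),
  critical_P5_K113_free k e -> forall v, #|e v| <= D.
Proof.
pose B := 1 + k.*2 + k.*2 ^ 2 + k.*2 ^ 3.
have [N NP] := trace_system_bound k.
(* With r = 1 this is the pigeonhole principle: among [M] components, [N] have the same type. *)
have [M MP] := ramsey 1 {ffun 'I_B * 'I_B -> bool} N.
exists (M * B) => T e crit v; have e_sym := crit_sym crit.
have csym := nbr_connect_sym crit v.
set K := connect (nbr_rel e v) in csym.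
(* One representative, the root, of each component of the neighbourhood. *)
pose s := [seq x <- enum (e v) | root (nbr_rel e v) x == x].
have sP x : x \in s -> e v x /\ root (nbr_rel e v) x = x.
  by rewrite mem_filter mem_enum => /andP[/eqP].
have lt_s : size s < M.
  rewrite ltnNge; apply/negP => /(MP T (fun u => if u is x :: _ then
    component_type k e v x else [ffun=> false])).
  case=> c [t [sts szt hom]].
  have tP x : x \in t -> e v x /\ root (nbr_rel e v) x = x.
    by move/(mem_subseq sts)/sP.
  have typeP x : x \in t -> component_type k e v x = c.
    by move=> xt; apply: (hom [:: x]); rewrite ?sub1seq.
  have diffP x y : x \in t -> y \in t -> x != y -> ~~ K x y.
    move=> /tP[_ rx] /tP[_ ry]; apply: contra.
    by rewrite /K -(root_connect csym) rx ry.
  (* The default [v] arises only if no separating vertex exists, which [separating_vertex] excludes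
     for distinct members of [t]. *)
  pose g i j := odflt v [pick u |
    [&& ~~ e v u, meets e v u i & ~~ complete_to e v u j]].
  suff : size t < N by rewrite szt ltnn.
  apply: (NP T T (fun u => ~~ e v u) e (meets e v) (complete_to e v) g).
  - by rewrite (subseq_uniq sts) // filter_uniq ?enum_uniq.
  - move=> u i /forallP/(_ i); rewrite connect0 /= => ui.
    by apply/existsP; exists i; rewrite connect0.
  - move=> u p q nvu pt qt Tp Fp Tq Fq; apply/eqP; apply: contraT => pq.
    case/negP: (diffP _ _ pt qt pq); case/tP: pt => vp _; case/tP: qt => vq _.
    exact: (mixed_component_unique crit vp vq Tp Fp Tq Fq).
  - move=> y z p q nvy nvz pt qt pq; have npq := diffP _ _ pt qt pq.
    case/tP: pt => vp _; case/tP: qt => vq _.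
    exact: (trace_diff_adjacent crit nvy nvz vp vq npq).
  - move=> y z p q r yz pt qt rt upqr.
    have comp u i : complete_to e v u i -> e u i.
      by move=> /forallP/(_ i); rewrite connect0.
    have nadj a b : a \in t -> b \in t -> a != b -> ~~ e a b.
      move=> ta tb ab; have nab := diffP _ _ ta tb ab.
      case/tP: ta => va _; case/tP: tb => vb _.
      exact: (nbr_nonadjacent crit va vb nab (connect0 _ _) (connect0 _ _)).
    move=> /comp yp /comp yq /comp yr /comp zp /comp zq /comp zr.
    move: (upqr); rewrite /= !inE negb_or andbT => /andP[/andP[pq pr] qr].
    by apply: (crit_K113 crit yz upqr); rewrite ?nadj.
  - exact: crit_clique crit.
  move=> i j it jt ij; rewrite /g; case: pickP => [u /and3P[] //|nosep].
  have nij := diffP _ _ it jt ij.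
  have eqt : component_type k e v i = component_type k e v j by rewrite !typeP.
  case/tP: it => vi _; case/tP: jt => vj _.
  by have [u] := separating_vertex crit vi vj nij eqt; rewrite nosep.
have /subset_leq_card/leq_trans -> // :
    e v \subset \bigcup_(i in [set x in s]) [set x | K i x].
  apply/subsetP=> x vx; apply/bigcupP; exists (root (nbr_rel e v) x).
    rewrite inE mem_filter root_root // eqxx mem_enum.
    exact: (nbr_component vx (connect_root _ _)).
  by rewrite inE /K csym connect_root.
have leB i : i \in [set x in s] -> #|[set x | K i x]| <= B.
  by move=> _; rewrite cardsE; apply: nbr_component_card crit v i.
apply: (leq_trans (card_bigcup_le leB)); rewrite leq_mul // cardsE.
exact: leq_trans (card_size s) (ltnW lt_s).
Qed.

Lemma crit_order_bound (k : nat) : exists N, forall (T : finType) (e : rel T),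
  critical_P5_K113_free k e -> #|T| <= N.
Proof.
have [D DP] := crit_degree_bound k.
exists (1 + D + D ^ 2 + D ^ 3) => T e crit.
case: (pickP T) => [x _|T0]; last by rewrite eq_card0.
have <- : #|connect e x| = #|T|.
  by apply: eq_card => y; apply: (crit_connected crit x y).
exact: component_card (crit_sym crit) (crit_P5 crit) (DP T e crit) x.
Qed.

(** * From forbidden induced subgraphs to adjacency conditions *)

Lemma is_free_no_embedding (H G : sgraph) (h : H -> G) : is_free H G ->
  injective h -> (forall x y, edge (h x) (h y) = edge x y) -> False.
Proof.
move=> freeG h_inj hE; pose S := h @: [set: H].
have hS x : h x \in S by rewrite imset_f.
pose h' x : induced S := exist _ (h x) (hS x).
have [g h'K gK] : bijective h'.
  apply: inj_card_bij => [x y [/h_inj] //|].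
  rewrite card_sig -[#|H|]cardsT -(card_imset setT h_inj).
  exact/subset_leq_card/subsetP.
apply: (freeG S); exists g; first by exists h'.
by move=> x y; rewrite -{2}[x]gK -{2}[y]gK; rewrite -hE.
Qed.

Lemma no_induced_P5 (G : sgraph) (a b c d x : G) : is_free P5 G ->
  edge a b -> edge b c -> edge c d -> edge d x -> ~~ edge a c ->
  ~~ edge a d -> ~~ edge a x -> ~~ edge b d -> ~~ edge b x -> ~~ edge c x ->
  False.
Proof.
move=> freeG ab bc cd dx /negPf ac /negPf ad /negPf ax /negPf bd /negPf bx.
move=> /negPf cx; pose h (i : P5) := nth a [:: a; b; c; d; x] i.
have hE i j : edge (h i) (h j) = edge i j.
  case: i j => [[|[|[|[|[|i]]]]] ilt] [[|[|[|[|[|j]]]]] jlt] //=;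
  by rewrite /h /= ?edge_irr ?ab ?bc ?cd ?dx ?ac ?ad ?ax ?bd ?bx ?cx //
    edge_sym ?ab ?bc ?cd ?dx ?ac ?ad ?ax ?bd ?bx ?cx.
(* Distinct vertices of P5 have distinct neighbourhoods. *)
apply: (is_free_no_embedding freeG _ hE) => i j hij.
have nbr p : edge i p = edge j p by rewrite -!hE hij.
apply/val_inj; move: (nbr (inord 0)) (nbr (inord 1)) (nbr (inord 2))
  (nbr (inord 3)) (nbr (inord 4)).
rewrite /= /path_edge !inordK //.
by case: i j {hij nbr} => [[|[|[|[|[|i]]]]] ilt] [[|[|[|[|[|j]]]]] jlt].
Qed.

(** Under complementation the triangle becomes the independent set p, q, r, and the two isolated
    vertices become x and y, adjacent to each other and to everything else. *)
Lemma no_induced_K113 (G : sgraph) (x y p q r : G) : is_free co_K3_2P1 G ->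
  edge x y -> uniq [:: p; q; r] -> ~~ edge p q -> ~~ edge p r -> ~~ edge q r ->
  edge x p -> edge x q -> edge x r -> edge y p -> edge y q -> edge y r -> False.
Proof.
move=> freeG xy /= /andP[]; rewrite !inE negb_or => /andP[pq pr] /andP[qr _].
move=> /negPf npq /negPf npr /negPf nqr xp xq xr yp yq yr.
pose h (i : co_K3_2P1) := match i with
  | inl i => nth p [:: p; q; r] i | inr (inl _) => x | inr (inr _) => y end.
have hE i j : edge (h i) (h j) = edge i j.
  case: i j => [[[|[|[|i]]] ilt]|[[[|i] ilt]|[[|i] ilt]]]
            [[[|[|[|j]]] jlt]|[[[|j] jlt]|[[|j] jlt]]] //=;
  by rewrite /h /= ?edge_irr ?xy ?xp ?xq ?xr ?yp ?yq ?yr ?npq ?npr ?nqr //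
    edge_sym ?xy ?xp ?xq ?xr ?yp ?yq ?yr ?npq ?npr ?nqr.
have uniq3 : uniq [:: p; q; r] by rewrite /= !inE negb_or pq pr qr.
apply: (is_free_no_embedding freeG _ hE) => i j hij.
(* Vertices with the same image are non-adjacent, so they are equal or both come from the triangle,
   where p, q, r are distinct. *)
have : ~~ edge i j by rewrite -hE hij edge_irr.
rewrite /= /compl_edge negb_and negbK => /orP[/eqP //|/negPn].
case: i j hij => [i|[i|i]] [j|[j|j]] //=.
  by move=> /eqP; rewrite nth_uniq // val_eqE => /eqP->.
all: by move=> _; rewrite !ord1 /path_edge.
Qed.

Lemma colorableP (G : sgraph) n :
  reflect (exists c : G -> 'I_n, forall x y, edge x y -> c x != c y)
          (colorable G n).
Proof.
apply: (iffP existsP) => -[c cP].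
  by exists c => x y; move/forallP/(_ x)/forallP/(_ y)/implyP: cP.
exists [ffun x => c x]; apply/forallP => x; apply/forallP => y.
by apply/implyP=> exy; rewrite !ffunE cP.
Qed.

Lemma colorable_leq (G : sgraph) m n : m <= n -> colorable G m -> colorable G n.
Proof.
move=> mn /colorableP[c cP]; apply/colorableP; exists (widen_ord mn \o c).
by move=> x y /cP; rewrite -!val_eqE.
Qed.

Lemma colorable_chromatic (G : sgraph) n :
  colorable G n = (chromatic_number G <= n).
Proof.
rewrite /chromatic_number; case: ex_minnP => m Gm m_min.
by apply/idP/idP => [/m_min | /colorable_leq]; last exact.
Qed.

Lemma vertex_critical_free k (G : sgraph) : 0 < k -> vertex_critical k G ->
  is_free P5 G -> is_free co_K3_2P1 G -> critical_P5_K113_free k (@edge G).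
Proof.
move=> k_gt0 [chiG crit] freeP5 freeK; split.
- exact: edge_sym.
- by move=> a b c d x; apply: no_induced_P5.
- by move=> x y p q r; apply: no_induced_K113.
- by apply/colorableP; rewrite colorable_chromatic chiG.
- move=> c c_lt cP; have : colorable G k.-1.
    apply/colorableP; exists (fun x => Ordinal (c_lt x)) => x y /cP.
    by rewrite -val_eqE.
  by rewrite colorable_chromatic chiG; case: (k) k_gt0 => // n _; rewrite ltnn.
move=> v; have /colorableP[c cP] : colorable (delete_vertex v) k.-1.
  by rewrite colorable_chromatic -ltnS prednK.
(* The default colour 0 applies only at v. *)
pose c' x :=
  if insub x : option (delete_vertex v) is Some y then c y : nat else 0.
have c'E x (xv : x \in [set~ v]) : c' x = c (exist _ x xv).
  by rewrite /c' insubT.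
exists c' => [x|x y]; first by rewrite -in_setC1 => xv; rewrite c'E ltn_ord.
rewrite -!in_setC1 => xv yv exy; rewrite !c'E; exact: cP.
Qed.

(** * Finiteness from bounded order *)

(** A graph is coded by its order, at most N, and a Boolean matrix. The relation [adj] symmetrises
    the matrix and clears its diagonal, so that every code yields a graph. *)
Lemma finitely_many_bounded_order (P : sgraph -> Prop) (N : nat) :
  (forall G, P G -> #|G| <= N) -> finitely_many_up_to_iso P.
Proof.
move=> leN.
pose adj (A : {ffun 'I_N.+1 * 'I_N.+1 -> bool}) n : rel 'I_n :=
  fun i j => (i != j) && (A (inord i, inord j) || A (inord j, inord i)).
have adj_sym A n : symmetric (adj A n).
  by move=> i j; rewrite /adj eq_sym orbC.
have adj_irr A n : irreflexive (adj A n) by move=> i; rewrite /adj eqxx.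
pose code := ('I_N.+1 * {ffun 'I_N.+1 * 'I_N.+1 -> bool})%type.
pose graph_of (x : code) := SGraph (adj_sym x.2 x.1) (adj_irr x.2 x.1).
exists #|{: code}|, (fun i => graph_of (enum_val i)) => G PG.
pose A : {ffun 'I_N.+1 * 'I_N.+1 -> bool} :=
  [ffun p : 'I_N.+1 * 'I_N.+1 => [exists x : G, exists y : G,
    [&& enum_rank x == p.1 :> nat, enum_rank y == p.2 :> nat & edge x y]]].
have ltG : #|G| < N.+1 by rewrite ltnS leN.
exists (enum_rank (Ordinal ltG, A)); rewrite enum_rankK /graph_of /=.
exists (fun x : G => enum_rank x).
  by exists enum_val; [apply: enum_rankK | apply: enum_valK].
have AE (x y : G) : A (inord (enum_rank x), inord (enum_rank y)) = edge x y.
  have lt (z : G) : enum_rank z < N.+1 by apply: ltn_trans ltG.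
  rewrite ffunE /= !inordK //.
  apply/existsP/idP => [[x' /existsP[y' /and3P[]]]|exy].
    by rewrite !val_eqE !(inj_eq enum_rank_inj) => /eqP-> /eqP->.
  by exists x; apply/existsP; exists y; rewrite !eqxx.
move=> x y; rewrite -[LHS]/(adj A _ (enum_rank x) (enum_rank y)) /adj !AE.
rewrite [edge y x]edge_sym orbb (inj_eq enum_rank_inj) andbC.
case exy: (edge x y) => //=.
by apply/negP=> /eqP eq_xy; rewrite eq_xy edge_irr in exy.
Qed.

Theorem theorem4 (k : nat) (k_ge1 : 1 <= k) :
  finitely_many_up_to_iso (fun G : sgraph =>
    [/\ vertex_critical k G, is_free P5 G & is_free co_K3_2P1 G]).
Proof.
have [N NP] := crit_order_bound k.
apply: (@finitely_many_bounded_order _ N) => G [critG P5G KG].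
exact/NP/vertex_critical_free.
Qed.
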